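(* Let $k$ be a field and let $A$ be an associative $k$-algebra. Then R-isomorphism is an equivalence relation on the class of objects $\mathrm{Obj}(\mathrm{Mod}(A))$ which is coarser than the module isomorphism relation (that is, isomorphic $A$-modules are R-isomorphic). Moreover, both the restriction function and the total restriction function are module invariants: isomorphic $A$-modules have equal restriction functions and equal total restriction functions.
   Context: $\mathrm{Mod}(A)$ is the category of all left $A$-modules. Subalgebras of $A$ are required to contain the multiplicative identity of $A$. For a subalgebra $A'\subseteq A$ and an $A$-module $M$, $\mathrm{res}_{A'}(M)$ denotes the restriction of $M$ to $A'$, and $[N]$ denotes the isomorphism class of a module $N$. Two $A$-modules $M_1,M_2$ are called R-isomorphic if $[\mathrm{res}_{A'}(M_1)]=[\mathrm{res}_{A'}(M_2)]$ (as $A'$-modules) for every proper subalgebra $A'\subset A$. The restriction function of $M$ is the function $A'\mapsto[\mathrm{res}_{A'}(M)]$ defined on the proper subalgebras $A'$ of $A$; the total restriction function of $M$ is the function given by the same formula on all subalgebras $A'\subseteq A$. *)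

(* Defs.v *)
From HB Require Import structures.
From mathcomp Require Import all_boot all_algebra.
From mathcomp Require Import boolp classical_sets.

Set Implicit Arguments.
Unset Strict Implicit.
Unset Printing Implicit Defensive.

Import GRing.Theory.
Local Open Scope ring_scope.
Local Open Scope classical_set_scope.

(* The library's [algType] requires 1 != 0; [assocAlgType k] drops that
   requirement, so that the zero algebra is included. *)
Record assocAlgType (k : fieldType) := AssocAlg {
  assoc_ring :> pzRingType;
  assoc_scale : k -> assoc_ring -> assoc_ring;
  assoc_scalerA : forall a b x,
    assoc_scale a (assoc_scale b x) = assoc_scale (a * b) x;
  assoc_scale1r : left_id 1 assoc_scale;
  assoc_scalerDr : right_distributive assoc_scale +%R;
  assoc_scalerDl : forall x, {morph assoc_scale^~ x : a b / a + b};
  assoc_scalerAl : forall a x y,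
    assoc_scale a (x * y) = assoc_scale a x * y;
  assoc_scalerAr : forall a x y,
    assoc_scale a (x * y) = x * assoc_scale a y
}.

Definition assocAlg_of_algType (k : fieldType) (A : algType k) :
    assocAlgType k :=
  @AssocAlg k A *:%R (@scalerA k A) (@scale1r k A) (@scalerDr k A)
    (@scalerDl k A) (@scalerAl k A) (@scalerAr k A).

Record subalgebra (k : fieldType) (A : assocAlgType k) := Subalgebra {
  subalg_set :> set A;
  subalg_1 : 1 \in subalg_set;
  subalg_linear : forall a : k,
    {in subalg_set &, forall x y, assoc_scale a x + y \in subalg_set};
  subalg_mul : {in subalg_set &, forall x y, x * y \in subalg_set}
}.

Section SubalgebraRing.
Variables (k : fieldType) (A : assocAlgType k) (A' : subalgebra A).

Definition subalg_pred : {pred A} := fun x => x \in subalg_set A'.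

Lemma subalg_pred_subring : GRing.subring_closed subalg_pred.
Proof.
have scaleN1 x : assoc_scale (- 1 : k) x = - x.
  apply/(addrI x); rewrite subrr -{1}[x]assoc_scale1r -assoc_scalerDl subrr.
  by apply/(addrI (assoc_scale 0 x)); rewrite -assoc_scalerDl !addr0.
split; [exact: subalg_1 | | exact: subalg_mul].
move=> x y xA yA; rewrite -[x - y]addrC -scaleN1.
exact: subalg_linear.
Qed.

Definition subalg_ring : Type := {x : A | subalg_pred x}.

HB.instance Definition _ := [isSub of subalg_ring for @sval _ _].
HB.instance Definition _ := [Choice of subalg_ring by <:].
HB.instance Definition _ :=
  GRing.SubChoice_isSubPzRing.Build A subalg_pred subalg_ring
    subalg_pred_subring.

End SubalgebraRing.

(* [A'] is a phantom parameter: it selects the module structure put on the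
   underlying group of [M] by the instance below. *)
Definition res (k : fieldType) (A : assocAlgType k) (A' : subalgebra A)
  (M : lmodType A) : Type := M.

Section Restriction.
Variables (k : fieldType) (A : assocAlgType k).
Variables (A' : subalgebra A) (M : lmodType A).

HB.instance Definition _ := GRing.Zmodule.copy (res A' M) M.

Definition res_scale (a : subalg_ring A') (v : res A' M) : res A' M :=
  (val a : A) *: (v : M).

Lemma res_scalerA a b v : res_scale a (res_scale b v) = res_scale (a * b) v.
Proof. by rewrite /res_scale scalerA rmorphM. Qed.

Lemma res_scale1r : left_id 1 res_scale.
Proof. by move=> v; rewrite /res_scale rmorph1 scale1r. Qed.

Lemma res_scalerDr : right_distributive res_scale +%R.
Proof. by move=> a u v; rewrite /res_scale scalerDr. Qed.

Lemma res_scalerDl v : {morph res_scale^~ v : a b / a + b}.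
Proof. by move=> a b; rewrite /res_scale rmorphD scalerDl. Qed.

HB.instance Definition _ :=
  GRing.Zmodule_isLmodule.Build (subalg_ring A') (res A' M)
    res_scalerA res_scale1r res_scalerDr res_scalerDl.

End Restriction.

(* For algebras over [k], [B]-linear maps are automatically [k]-linear, as
   [k] acts through [B]; hence only the ring underlying the algebra is used. *)
Definition module_iso (B : pzRingType) (M N : lmodType B) : Prop :=
  exists f : {linear M -> N}, bijective f.

(* The isomorphism class [N] as a class of modules.  It is not a
   [set (lmodType B)] for universe reasons. *)
Definition iso_class (B : pzRingType) (N : lmodType B) : lmodType B -> Prop :=
  module_iso N.

Definition proper_subalg (k : fieldType) (A : assocAlgType k)
    (A' : subalgebra A) : Prop :=
  A' `<` [set: A].

Definition R_isomorphic (k : fieldType) (A : assocAlgType k)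
    (M1 M2 : lmodType A) : Prop :=
  forall A' : subalgebra A, proper_subalg A' ->
    iso_class (res A' M1) = iso_class (res A' M2).

Definition restriction_function (k : fieldType) (A : assocAlgType k)
    (M : lmodType A) :
    forall A' : {A' : subalgebra A | proper_subalg A'},
      lmodType (subalg_ring (sval A')) -> Prop :=
  fun A' => iso_class (res (sval A') M).

Definition total_restriction_function (k : fieldType) (A : assocAlgType k)
    (M : lmodType A) :
    forall A' : subalgebra A, lmodType (subalg_ring A') -> Prop :=
  fun A' => iso_class (res A' M).

(* Main.v *)
Require Import Defs.
From Stdlib Require Import RelationClasses.
From HB Require Import structures.
From mathcomp Require Import all_boot all_algebra.
From mathcomp Require Import boolp.

Import GRing.Theory.
Local Open Scope ring_scope.

(** Restriction to a subalgebra is functorial and leaves maps unchanged, so an isomorphism over [A]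
    is also one over every [A'] ([module_iso_res]). Isomorphic modules have equal classes
    ([iso_class_eq]), which yields the three invariance claims. R-isomorphism is an equivalence
    because it is defined by equalities of classes. *)

Lemma module_iso_sym (B : pzRingType) (M N : lmodType B) :
  module_iso M N -> module_iso N M.
Proof.
case=> f [g fK gK].
have gP : linear g by move=> a x y; rewrite -[RHS]fK linearP !gK.
pose gL : {linear N -> M} :=
  HB.pack g (GRing.isLinear.Build B N M *:%R g gP).
by exists gL, f.
Qed.

Lemma module_iso_trans (B : pzRingType) (M N P : lmodType B) :
  module_iso M N -> module_iso N P -> module_iso M P.
Proof.
by move=> [f fB] [g gB]; exists (g \o f : {linear M -> P}); apply: bij_comp.
Qed.

(** Classes are predicates, so by extensionality their equality reduces to symmetry and transitivity
    of [module_iso]. *)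
Lemma iso_class_eq (B : pzRingType) (M N : lmodType B) :
  module_iso M N -> iso_class M = iso_class N.
Proof.
move=> MN; apply/funext => P; apply/propext; split.
  by apply: module_iso_trans; apply: module_iso_sym.
exact: module_iso_trans.
Qed.

Lemma module_iso_res (k : fieldType) (A : assocAlgType k) (A' : subalgebra A)
    (M N : lmodType A) :
  module_iso M N -> module_iso (res A' M) (res A' N).
Proof.
case=> f fB.
have fP : linear (f : res A' M -> res A' N).
  (* By definition [a] acts on a restriction as [val a] acts on the original module. *)
  by move=> a x y; apply: (linearP f (val a)).
pose fL : {linear res A' M -> res A' N} :=
  HB.pack (f : res A' M -> res A' N)
    (GRing.isLinear.Build (subalg_ring A') (res A' M) (res A' N) *:%R f fP).
by exists fL.
Qed.

Theorem proposition3p1 (k : fieldType) (A : assocAlgType k) :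
  [/\ Equivalence (fun M1 M2 : lmodType A => R_isomorphic M1 M2),
      (forall M1 M2 : lmodType A, module_iso M1 M2 -> R_isomorphic M1 M2),
      (forall M1 M2 : lmodType A, module_iso M1 M2 ->
         restriction_function M1 = restriction_function M2)
    & (forall M1 M2 : lmodType A, module_iso M1 M2 ->
         total_restriction_function M1 = total_restriction_function M2)].
Proof.
have class_res (M N : lmodType A) (A' : subalgebra A) :
    module_iso M N -> iso_class (res A' M) = iso_class (res A' N).
  by move=> MN; apply/iso_class_eq/module_iso_res.
split=> [|M N MN A' _|M N MN|M N MN]; last 3 first.
- exact: class_res.
(* Extensionality must be dependent: the type of the value, a predicate on modules over [A'], varies
   with [A']. *)
- by apply: functional_extensionality_dep => A'; apply: class_res.
- by apply: functional_extensionality_dep => A'; apply: class_res.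
split=> [M A' _ // | M N MN A' pA' | M N P MN NP A' pA'].
  by rewrite MN.
by rewrite MN // NP.
Qed.
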